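(* Let $p$ be an odd prime, $e$ a positive integer, $q=p^e$ and $Q=q^2$. Let $T\in\mathbb{F}_Q[X,Y,Z]$ be the polynomial $$T(X,Y,Z) = XY-2^{-1}t_{(Q+1)/2}(X)\,t_q(Y) + Z - \sum_{i=0}^{q-2}g_i(X)\,t_q(Y)^{i+1}\,t_q(Z)^{q-(i+1)},$$ where $$g_i(X) = (-4)^{-(i+1)}\sum_{j=0}^{i+1} C[j(q-1)+i]\,X^{j(q-1)+i+1}.$$ For $y,z\in\mathbb{F}_Q$ define $f_{y,z}(X)=T(X,y,z)\in\mathbb{F}_Q[X]$. The following statements hold for all $y,z\in\mathbb{F}_Q$. (i) If $y\in\mathbb{F}_q$, then $\delta_{f_{y,z}}=Q$. (ii) If $y\notin\mathbb{F}_q$, then $\delta_{f_{y,z}}=(Q+3)/4$.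
   Context: $\mathbb{F}_Q$ is the finite field with $Q$ elements and $\mathbb{F}_q$ its subfield with $q$ elements. $t_n(X)=X^n-X$. $C[n]=\frac{1}{n+1}\binom{2n}{n}$ is the $n$-th Catalan number; integers (and inverses of integers prime to $p$) are read in $\mathbb{F}_p\subset\mathbb{F}_Q$ when used as coefficients. For $f\in\mathbb{F}_Q[X]$, the uniformity of $f$ is $u(f)=\max_{b\in\mathbb{F}_Q}\#\{a\in\mathbb{F}_Q : f(a)=b\}$. For $a\in\mathbb{F}_Q\setminus\{0\}$, $\Delta_{f,a}(x)=f(x+a)-f(x)$. The differential uniformity of $f$ over $\mathbb{F}_Q$ is $\delta_f=\max_{a\in\mathbb{F}_Q\setminus\{0\}}u(\Delta_{f,a})$. *)

(* Defs.v *)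
From HB Require Import structures.
From mathcomp Require Import all_boot all_order all_algebra.
From mathcomp Require Import mpoly.

Set Implicit Arguments.
Unset Strict Implicit.
Unset Printing Implicit Defensive.

Import GRing.Theory.
Local Open Scope ring_scope.

Section Uniformity.
Variable F : finFieldType.

Definition uniformity (f : {poly F}) : nat :=
  \max_(b : F) #|[set a : F | f.[a] == b]|.

Definition Delta (f : {poly F}) (a : F) : {poly F} := f \Po ('X + a%:P) - f.

Definition diff_uniformity (f : {poly F}) : nat :=
  \max_(a : F | a != 0) uniformity (Delta f a).

End Uniformity.

(* The division is exact. *)
Definition catalan (n : nat) : nat := ('C(2 * n, n) %/ n.+1)%N.

Definition tpoly (R : nzRingType) (n : nat) : {poly R} := 'X^n - 'X.

Definition gpoly (F : fieldType) (q i : nat) : {poly F} :=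
  (- 4%:R) ^- i.+1 *:
    \sum_(j < i.+2) (catalan (j * q.-1 + i))%:R *: 'X^(j * q.-1 + i.+1).

(* X, Y, Z are the variables 'X_0, 'X_1, 'X_2, and [horner_alg P p] is p(P) for
   a univariate p. The natural number (q ^ 2).+1 %/ 2 is (Q + 1) / 2 exactly,
   since q is odd. *)
Definition Tpoly (F : fieldType) (q : nat) : {mpoly F[3]} :=
  let X := 'X_0 : {mpoly F[3]} in
  let Y := 'X_1 : {mpoly F[3]} in
  let Z := 'X_2 : {mpoly F[3]} in
  X * Y
  - 2%:R^-1 *: (horner_alg X (tpoly F ((q ^ 2).+1 %/ 2))
                * horner_alg Y (tpoly F q))
  + Z
  - \sum_(i < q.-1) horner_alg X (gpoly F q i)
      * horner_alg Y (tpoly F q) ^+ i.+1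
      * horner_alg Z (tpoly F q) ^+ (q - i.+1).

(* T(X, y, z) as a univariate polynomial. *)
Definition fpoly (F : fieldType) (q : nat) (y z : F) : {poly F} :=
  mmap (@polyC F) (tnth [tuple 'X; y%:P; z%:P]) (Tpoly F q).

(* Main.v *)
(* Write N = (Q + 1) / 2. If y is not in F_q, then c = t_q(z) / t_q(y) lies in
   F_q. In characteristic p, (1 - 4 X) ^ N and the Catalan series
   1 - 2 X C(X) = sqrt (1 - 4 X) agree modulo X ^ Q; expanding (X + 1) ^ N,
   where Lucas's theorem kills the terms missing from the g_i, gives
     sum_i g_i(X) = (X ^ N - (X + 1) ^ N + 1) / 2,
   and therefore f_(y,z)(x) = f_(y,0)(x + c) + z - c y on F_Q. Now f_(y,0)(x) is
   y x if x is a square and y ^ q x otherwise, so the fibres of its derivative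
   in direction 1 over y and y ^ q are the pairs of consecutive squares and of
   consecutive nonsquares, while its other fibres have at most two points.
   Inversion x |-> 1/x, which turns x + 1 into (x + 1) / x, shows that there are
   (Q + 3) / 4 pairs of consecutive squares, 0 included. *)

Require Import Defs.
From mathcomp Require Import all_boot all_order all_algebra all_field.
From mathcomp Require Import mpoly.
From mathcomp Require Import ring zify.

Set Implicit Arguments.
Unset Strict Implicit.
Unset Printing Implicit Defensive.

Import GRing.Theory.
Local Open Scope ring_scope.

(** * The Catalan series as a square root *)

(** The identity (n + 1) C(2n, n + 1) = n C(2n, n) shows that n + 1, being prime to n, divides C(2n,
    n). *)
Lemma mul_catalan n : (n.+1 * catalan n = 'C(2 * n, n))%N.
Proof.
rewrite /catalan mulnC divnK //.
have := mul_bin_left (2 * n) n; rewrite mul2n -addnn addnK => E.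
have : (n.+1 %| n * 'C(n + n, n))%N by rewrite -E dvdn_mulr.
by rewrite Gauss_dvdr // coprimeSn.
Qed.

Lemma central_bin_rec n :
  (n.+1 * 'C(2 * n.+1, n.+1) = 2 * (2 * n).+1 * 'C(2 * n, n))%N.
Proof.
have -> : (2 * n.+1 = (2 * n).+2)%N by rewrite !mul2n doubleS.
have := mul_bin_diag (2 * n).+2 n; rewrite /= => <-.
have := mul_bin_down (2 * n).+1 n; rewrite /= => E.
rewrite -mulnA E; have -> : ((2 * n).+1 - n = n.+1)%N by lia.
by rewrite mulnA; congr (_ * _)%N; lia.
Qed.

Lemma catalan_rec n :
  (n.+2 * catalan n.+1 = 2 * (2 * n).+1 * catalan n)%N.
Proof.
apply/eqP; rewrite -(eqn_pmul2l (ltn0Sn n)); apply/eqP.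
rewrite mul_catalan central_bin_rec -mul_catalan; lia.
Qed.

(* Taylor coefficients of sqrt (1 - 4 X). *)
Definition sqrt_coef (n : nat) : int :=
  if n is m.+1 then - (2 * catalan m)%:Z else 1.

Lemma sqrt_coef_rec n :
  n.+1%:Z * sqrt_coef n.+1 = (4 * n%:Z - 2) * sqrt_coef n.
Proof.
case: n => [|n]; first by [].
have := catalan_rec n; rewrite /sqrt_coef; lia.
Qed.

(* The differential equation (1 - 4 X) A' = - 2 A of the generating series A
   gives (1 - 4 X) (A ^ 2)' = - 4 A ^ 2, whose solutions are the multiples of
   1 - 4 X. *)
Lemma sqrt_coef_conv n :
  \sum_(i < n.+1) sqrt_coef i * sqrt_coef (n - i) =
  if n is m.+1 then if m is 0%N then - 4%:Z else 0 else 1.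
Proof.
(* [s] lists the coefficients of A ^ 2 and [w] those of X A' A; the symmetry i <-> m - i gives 2 w =
   m s. *)
pose s m : int := \sum_(i < m.+1) sqrt_coef i * sqrt_coef (m - i).
pose w m : int := \sum_(i < m.+1) i%:Z * (sqrt_coef i * sqrt_coef (m - i)).
have ws m : 2 * w m = m%:Z * s m.
  rewrite mulr_natl mulr2n {2}/w (reindex_inj rev_ord_inj) /= -big_split /=.
  rewrite /s mulr_sumr; apply: eq_bigr => i _.
  have lei : (i <= m)%N by rewrite -ltnS.
  rewrite subSS subKn // [sqrt_coef (m - i) * _]mulrC -mulrDl; congr (_ * _).
  by rewrite -PoszD subnKC.
have srec m : m.+1%:Z * s m.+1 = (4 * m%:Z - 4) * s m.
  rewrite -ws /w big_ord_recl mul0r add0r.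
  transitivity (2 * (4 * w m - 2 * s m)); last by have := ws m; lia.
  congr (_ * _); rewrite /w /s !mulr_sumr -sumrB; apply: eq_bigr => i _.
  rewrite /= /bump /= add1n subSS mulrA sqrt_coef_rec; ring.
rewrite -/(s n).
case: n => [|[|n]]; first by rewrite /s big_ord_recl big_ord0.
  by have := srec 0%N; rewrite {2}/s big_ord_recl big_ord0 /=; lia.
elim: n => [|n IHn]; first by have := srec 1%N; lia.
have := srec n.+2; rewrite IHn mulr0 => /eqP; rewrite mulf_eq0 => /orP[] //.
by move/eqP.
Qed.

(** Since k C(a p ^ e, k) is a multiple of p ^ e, either p divides the binomial coefficient or p ^ e
    divides k. *)
Lemma dvdn_bin_expM p e a k : prime p ->
  ~~ (p ^ e %| k)%N -> (p %| 'C(a * p ^ e, k))%N.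
Proof.
move=> pp; case: k => [|k]; rewrite ?dvdn0 // => Nk.
apply: contraR Nk => Np; rewrite -(@Gauss_dvdl _ _ 'C(a * p ^ e, k.+1)).
  by rewrite -mul_bin_diag -mulnA mulnCA dvdn_mulr.
by rewrite coprimeXl // prime_coprime.
Qed.

(** A case of Lucas's theorem. In Vandermonde's sum p divides C(a p ^ e, i) unless p ^ e divides i,
    and then the cofactor has lower index at least v > b, so it is 0. *)
Lemma dvdn_bin_digits p e a b u v : prime p -> (b < v < p ^ e)%N ->
  (p %| 'C(a * p ^ e + b, u * p ^ e + v))%N.
Proof.
move=> pp /andP[ltbv ltv]; rewrite -binomial.Vandermonde.
apply: dvdn_sum => -[i /= lti] _.
have [/dvdnP[k ik]|Nk] := boolP (p ^ e %| i)%N; last first.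
  by rewrite dvdn_mulr // dvdn_bin_expM.
have leku : (k <= u)%N.
  rewrite -ltnS -(ltn_pmul2r (leq_ltn_trans (leq0n _) ltv)) -ik.
  by apply: leq_trans lti _; rewrite mulSn addnC; lia.
rewrite (@bin_small b) ?muln0 // ik.
by rewrite addnC -addnBA ?leq_mul2r ?leku ?orbT //; lia.
Qed.

Lemma coef_expr1DZX (R : comNzRingType) (c : R) n m :
  ((1 + c *: 'X) ^+ n)`_m = c ^+ m *+ 'C(n, m).
Proof.
elim: n m => [|n IHn] m; first by rewrite expr0 coef1; case: m.
rewrite exprS mulrDl mul1r -scalerAl coefD coefZ coefXM !IHn.
case: m => [|m]; first by rewrite mulr0 addr0 !bin0.
by rewrite /= binS mulrnDr mulrnAr -exprS.
Qed.

(* Modulo 'X^Q, both sides are coefficients of a square root of 1 - 4 X with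
   constant term 1: (1 - 4 X) ^ (Q + 1) = (1 - 4 X) (1 - (4 X) ^ Q). *)
Lemma bin_half_sqrt_coef (F : fieldType) (Q N m : nat) :
  [pchar F].-nat Q -> 2%:R != 0 :> F -> (2 * N = Q.+1)%N -> (m < Q)%N ->
  (- 4%:R) ^+ m *+ 'C(N, m) = (sqrt_coef m)%:~R :> F.
Proof.
move=> pcharQ n2 NQ ltmQ; set c : F := - 4%:R.
pose B : {poly F} := (1 + c *: 'X) ^+ N.
pose A : {poly F} := \poly_(i < Q) (sqrt_coef i)%:~R.
have cA i : (i < Q)%N -> A`_i = (sqrt_coef i)%:~R by rewrite coef_poly => ->.
have A2 i : (i < Q)%N -> (A * A)`_i = (1 + c *: 'X)`_i.
  move=> ltiQ; rewrite coefM.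
  transitivity ((\sum_(j < i.+1) sqrt_coef j * sqrt_coef (i - j))%:~R : F).
    rewrite rmorph_sum; apply: eq_bigr => -[j /= ltj] _.
    by rewrite rmorphM /= !cA //; lia.
  rewrite sqrt_coef_conv coefD coef1 coefZ coefX /c.
  by case: i {ltiQ} => [|[|i]] //=;
    rewrite ?mulr0 ?mulr1 ?addr0 ?add0r ?rmorphN.
have B2 : B * B = (1 + c *: 'X) + (1 + c *: 'X) * (c ^+ Q *: 'X^Q).
  rewrite -exprD addnn -mul2n NQ exprS exprDn_pchar ?expr1n; last first.
    by rewrite (eq_pnat _ (pchar_poly F)).
  by rewrite mulrDr mulr1 exprZn -scalerAr.
have dvd : 'X^Q %| (A - B) * (A + B).
  have -> : (A - B) * (A + B) = A * A - B * B by ring.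
  rewrite B2 opprD addrA; apply: dvdp_sub; last first.
    by apply/dvdpP; exists (c ^+ Q *: (1 + c *: 'X));
      rewrite -scalerAl scalerAr.
  rewrite -[X in _ %| X](poly_take_drop Q) dvdp_add ?dvdp_mulIr //.
  suff -> : take_poly Q (A * A - (1 + c *: 'X)) = 0 by rewrite dvdp0.
  apply/polyP=> i; rewrite coef_take_poly coef0 coefB.
  by case: ifP => // lti; rewrite A2 // subrr.
(* [A + B] has constant term 2, which is nonzero, so all of 'X^Q divides [A - B]. *)
have cop : coprimep 'X^Q (A + B).
  apply: coprimep_expl; rewrite coprimep_sym -['X]subr0 -polyC0 coprimep_XsubC.
  rewrite /root horner_coef0 coefD cA ?coef_expr1DZX ?bin0 //=; last by lia.
move: dvd; rewrite Gauss_dvdpl // => /dvdpP[q AB].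
have : (A - B)`_m = 0 by rewrite AB coefMXn ltmQ.
by rewrite coefB cA // coef_expr1DZX => /eqP; rewrite subr_eq0 => /eqP ->.
Qed.

(** * The sum of the polynomials g_i *)

Lemma natr_pchar_exp (R : nzRingType) p e n :
  p \in [pchar R] -> n%:R ^+ (p ^ e) = n%:R :> R.
Proof.
move=> pR; elim: e => [|e IHe]; first by rewrite expr1.
by rewrite expnSr exprM IHe -(pFrobenius_autE pR) pFrobenius_aut_nat.
Qed.

Lemma natr_odd_neq0 (F : fieldType) p k :
  p \in [pchar F] -> odd p -> (2 ^ k)%:R != 0 :> F.
Proof.
move=> pF p_odd; rewrite -(dvdn_pcharf pF).
have pp : prime p := pcharf_prime pF.
rewrite (Euclid_dvdX _ _ pp) dvdn_prime2 //; apply/negP => /andP[/eqP p2 _].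
by rewrite p2 in p_odd.
Qed.

Lemma ltn_half_digits h j i :
  (j * h.*2 + i.+1 < h * h.*2.+1 + h.+1)%N -> (j <= h)%N.
Proof.
move=> ltm; rewrite leqNgt; apply/negP => lthj.
have : (h.+1 * h.*2 <= j * h.*2)%N by rewrite leq_mul2r lthj orbT.
by move: ltm; rewrite -!mul2n; nia.
Qed.

(* In base q the digits of N = (q ^ 2 + 1) / 2 are (q - 1) / 2 and (q + 1) / 2;
   the low digit of m = j (q - 1) + i + 1 exceeds (q + 1) / 2 when j > i + 1. *)
Lemma dvdn_bin_half p e q N i j : prime p -> q = (p ^ e)%N -> odd q ->
  (2 * N = (q ^ 2).+1)%N -> (i.+1 < j)%N ->
  (j * q.-1 + i.+1)%N != N -> (p %| 'C(N, j * q.-1 + i.+1))%N.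
Proof.
move=> pp qE q_odd NE ltij.
rewrite neq_ltn => /orP[ltmN|ltNm]; last by rewrite bin_small.
have [h qh] : exists h, q = h.*2.+1.
  by exists q./2; rewrite -[LHS]odd_double_half q_odd.
have Nh : (N = h * q + h.+1)%N by move: NE; rewrite qh -mul2n; nia.
(* This bound keeps the low digit q + i + 1 - j above h + 1. *)
have lejh : (j <= h)%N.
  by apply: (@ltn_half_digits h j i); move: ltmN; rewrite Nh qh.
have -> : (j * q.-1 + i.+1 = j.-1 * q + (q + i.+1 - j))%N.
  by case: j ltij lejh {ltmN} => // j ltij lejh; rewrite qh -!mul2n /=; nia.
by rewrite Nh {1 2}qE dvdn_bin_digits // -qE qh -!mul2n; apply/andP; split; lia.
Qed.

(** With q = 2 h + 1, N = (h + 1) (q - 1) + 1, so equality would force i = 0 and j = h + 1 > 1.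
    Hence no g_i has a term of degree N. *)
Lemma half_digits_neq q N i j : odd q -> (1 < q)%N -> (2 * N = (q ^ 2).+1)%N ->
  (i < q.-1)%N -> (j < i.+2)%N -> (j * q.-1 + i.+1)%N != N.
Proof.
move=> q_odd q_gt1 NE ltiq ltji; apply/eqP => mN.
have [h qh] : exists h, q = h.*2.+1.
  by exists q./2; rewrite -[LHS]odd_double_half q_odd.
have Nh : (N = h.+1 * h.*2 + 1)%N by move: NE; rewrite qh -mul2n; nia.
have h0 : (0 < h)%N by lia.
case: (ltngtP j h.+1) => [ltjh|ltjh|E].
- have : (j * h.*2 <= h * h.*2)%N by rewrite leq_mul2r -ltnS ltjh orbT.
  by move: mN ltiq; rewrite Nh qh /= mulSn; lia.
- have : (h.+2 * h.*2 <= j * h.*2)%N by rewrite leq_mul2r ltjh orbT.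
  by move: mN ltiq; rewrite Nh qh /= mulSn; lia.
- by move: mN ltiq ltji; rewrite Nh qh /= E; lia.
Qed.

Lemma sum_gpoly (F : fieldType) p e q N : p \in [pchar F] -> odd p ->
  (0 < e)%N -> q = (p ^ e)%N -> (2 * N = (q ^ 2).+1)%N ->
  \sum_(i < q.-1) gpoly F q i = 2%:R^-1 *: ('X^N - ('X + 1) ^+ N + 1).
Proof.
move=> pF p_odd e_gt0 qE NE.
have pp : prime p := pcharf_prime pF.
have q_odd : odd q by rewrite qE oddX p_odd orbT.
have q_gt1 : (1 < q)%N by rewrite qE -(exp1n e) ltn_exp2r // prime_gt1.
have pcharQ : [pchar F].-nat (q ^ 2)%N.
  by rewrite (eq_pnat _ (pcharf_eq pF)) qE -expnM pnatX pnat_id.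
have n2 : 2%:R != 0 :> F := natr_odd_neq0 1 pF p_odd.
have n4 : - 4%:R != 0 :> F by rewrite oppr_eq0 (natr_odd_neq0 2 pF p_odd).
(* Hence (- 4) ^ m depends only on i when m = j (q - 1) + i + 1, which explains the common factor of
   g_i. *)
have Fermat4 : (- 4%:R) ^+ q.-1 = 1 :> F.
  apply: (mulfI n4); rewrite mulr1 -exprS prednK ?(ltnW q_gt1) //.
  by rewrite exprNn -signr_odd q_odd expr1 qE natr_pchar_exp // mulN1r.
have ltNQ : (N < q ^ 2)%N.
  by have := ltn_exp2r 1 q (ltn0Sn 1); rewrite exp1n q_gt1; lia.
(* The coefficient of X ^ m on the right-hand side. *)
pose r m : F := 2%:R^-1 * ((m == N)%:R - 'C(N, m)%:R + (m == 0%N)%:R).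
have QE : (q ^ 2 = (q.+1 * q.-1).+1)%N.
  rewrite expnS expn1; move: q_gt1; clear; case: q => //= k _.
  by rewrite mulSn; lia.
have -> : 2%:R^-1 *: ('X^N - ('X + 1) ^+ N + 1) = \poly_(m < q ^ 2) r m.
  apply/polyP=> m; rewrite coef_poly coefZ coefD coefB coefXn coef1.
  rewrite ['X + 1]addrC -['X]scale1r coef_expr1DZX expr1n -/(r m).
  case: ltnP => // /(leq_trans ltNQ) ltNm; rewrite /r bin_small //.
  by rewrite gtn_eqF // (gtn_eqF (leq_ltn_trans _ ltNm)) // addr0 subr0 mulr0.
rewrite poly_def QE big_ord_recl /= {1}/r bin0 eqxx.
rewrite (_ : 0%N == N = false); last by apply/eqP; lia.
rewrite sub0r addNr mulr0 scale0r add0r.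
transitivity (\sum_(0 <= n < (q.+1 * q.-1)%N) r n.+1 *: 'X^(n.+1) : {poly F});
  last first.
  by rewrite big_mkord.
(* As Q - 1 = (q + 1) (q - 1), each degree from 1 to Q - 1 is j (q - 1) + i + 1 for a unique pair
   with j <= q and i < q - 1. *)
rewrite big_nat_mul big_mkord.
transitivity (\sum_(j < q.+1) \sum_(i < q.-1)
    r (j * q.-1 + i.+1)%N *: 'X^(j * q.-1 + i.+1) : {poly F}); last first.
  apply: eq_bigr => j _; rewrite -{3}[(j * _)%N]add0n big_addn mulSn addnK.
  rewrite big_mkord.
  by apply: eq_bigr => i _; rewrite -addSn addnC.
rewrite exchange_big; apply: eq_bigr => -[i /= lti] _.
rewrite /gpoly scaler_sumr.
rewrite (big_ord_widen q.+1 (fun j => (- 4%:R) ^- i.+1 *: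
  ((catalan (j * q.-1 + i))%:R *: 'X^(j * q.-1 + i.+1)) : {poly F}));
  last by lia.
rewrite big_mkcond; apply: eq_bigr => -[j /= ltj] _.
have m0 : (j * q.-1 + i.+1 == 0)%N = false by rewrite addnS.
case: ltnP => ltij; last first.
  (* In degree N the leading terms of X ^ N and (X + 1) ^ N cancel. *)
  rewrite /r m0 addr0; have [->|mN] := eqVneq (j * q.-1 + i.+1)%N N.
    by rewrite binn subrr mulr0 scale0r.
  have /dvdnP[k ->] := dvdn_bin_half pp qE q_odd NE ltij mN.
  by rewrite natrM (pcharf0 pF) mulr0 subr0 mulr0 scale0r.
rewrite scalerA; congr (_ *: _); rewrite /r m0 addr0.
rewrite (negPf (half_digits_neq q_odd q_gt1 NE lti ltij)) sub0r.
have ltmQ : (j * q.-1 + i.+1 < q ^ 2)%N.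
  have : (j * q.-1 <= q * q.-1)%N by rewrite leq_mul2r -ltnS ltj orbT.
  by rewrite QE; lia.
have := bin_half_sqrt_coef pcharQ n2 NE ltmQ.
rewrite exprD mulnC exprM Fermat4 expr1n mul1r addnS => E.
apply: (mulfI n2); rewrite [RHS]mulrA mulfV // mul1r.
have n4i := expf_neq0 i.+1 n4; apply: (mulfI n4i).
rewrite [RHS]mulrN [X in _ = - X]mulr_natr E rmorphN opprK mulrCA mulVKf //.
by rewrite -natrM.
Qed.

(** * Evaluation of f_(y,z) *)

Lemma mmap_horner_algX (R : comNzRingType) n (h : 'I_n -> {poly R}) i
    (p : {poly R}) :
  mmap (@polyC R) h (horner_alg ('X_i : {mpoly R[n]}) p) = p \Po h i.
Proof.
elim/poly_ind: p => [|p c IHp]; first by rewrite rmorph0 comp_poly0 mmap0.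
rewrite rmorphD rmorphM /= horner_algX horner_algC comp_polyD comp_polyM.
rewrite comp_polyX comp_polyC mmapD mmapZ rmorph1 mulr1; congr (_ + _).
by rewrite rmorphM /= IHp mmapX mmap1U.
Qed.

Lemma horner_fpoly (F : fieldType) q (y z x : F) :
  (fpoly q y z).[x] =
    x * y - 2%:R^-1 * ((x ^+ ((q ^ 2).+1 %/ 2) - x) * (y ^+ q - y)) + z
    - \sum_(i < q.-1) (gpoly F q i).[x] * (y ^+ q - y) ^+ i.+1
                      * (z ^+ q - z) ^+ (q - i.+1).
Proof.
rewrite /fpoly /Tpoly; set h := tnth _.
have X0 : mmap (@polyC F) h 'X_0 = 'X by rewrite mmapX mmap1U.
have X1 : mmap (@polyC F) h 'X_1 = y%:P by rewrite mmapX mmap1U.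
have X2 : mmap (@polyC F) h 'X_2 = z%:P by rewrite mmapX mmap1U.
rewrite rmorphB rmorphD rmorphB !rmorphM /= mmapZ rmorph_sum rmorphM /=.
rewrite !mmap_horner_algX X0 X1 X2.
rewrite !(hornerE, horner_comp, horner_sum) /tpoly.
congr (_ - _); apply: eq_bigr => i _.
by rewrite !rmorphM !rmorphXn /= !mmap_horner_algX !(hornerE, horner_comp).
Qed.

(** All exponents in g_i are congruent to i + 1 modulo q - 1. *)
Lemma horner_gpoly_mull (F : fieldType) q i (c x : F) : c ^+ q.-1 = 1 ->
  (gpoly F q i).[c * x] = c ^+ i.+1 * (gpoly F q i).[x].
Proof.
move=> cq; rewrite /gpoly !hornerZ !horner_sum mulrCA; congr (_ * _).
rewrite mulr_sumr; apply: eq_bigr => j _.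
by rewrite !hornerZ !hornerXn exprMn exprD mulnC exprM cq expr1n mul1r mulrCA.
Qed.

(** The q-th power map is an involution on F, so it negates t_q(y); quotients of such values are
    fixed by it. *)
Lemma exp_Frobenius_diff (F : finFieldType) p e q (y : F) : p \in [pchar F] ->
  odd p -> q = (p ^ e)%N -> #|F| = (q ^ 2)%N ->
  (y ^+ q - y) ^+ q = - (y ^+ q - y).
Proof.
move=> pF p_odd qE cardF.
have pcharq : [pchar F].-nat q.
  by rewrite (eq_pnat _ (pcharf_eq pF)) qE pnatX pnat_id // (pcharf_prime pF).
have q_odd : odd q by rewrite qE oddX p_odd orbT.
rewrite exprDn_pchar // exprNn -signr_odd q_odd expr1 -exprM mulnn -cardF.
by rewrite expf_card mulN1r opprB.
Qed.

(* With c = t_q(z) / t_q(y) in F_q, the polynomial f_(y,z) is f_(y,0)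
   translated by c, up to an additive constant. *)
Lemma horner_fpoly_shift (F : finFieldType) p e q N (y z x : F) :
  p \in [pchar F] -> odd p -> (0 < e)%N -> q = (p ^ e)%N -> #|F| = (q ^ 2)%N ->
  (2 * N = (q ^ 2).+1)%N -> y ^+ q != y ->
  let c := (z ^+ q - z) / (y ^+ q - y) in
  (fpoly q y z).[x] =
    (x + c) * y - 2%:R^-1 * (((x + c) ^+ N - (x + c)) * (y ^+ q - y))
    + (z - c * y).
Proof.
move=> pF p_odd e_gt0 qE cardF NE Ny c.
have := exp_Frobenius_diff y pF p_odd qE cardF.
have := exp_Frobenius_diff z pF p_odd qE cardF.
rewrite horner_fpoly -NE mulKn //.
move: Ny; rewrite -subr_eq0 {}/c.
set a := y ^+ q - y; set b := z ^+ q - z => a0 bq aq.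
set c := b / a; have bE : b = c * a by rewrite /c divfK.
have q_odd : odd q by rewrite qE oddX p_odd orbT.
have q_gt1 : (1 < q)%N.
  by rewrite qE -(exp1n e) ltn_exp2r // prime_gt1 ?(pcharf_prime pF).
have [c0|cn0] := eqVneq c 0.
  rewrite big1 ?c0; first by rewrite addr0; ring.
  move=> [i /= lti] _; rewrite bE c0 mul0r expr0n.
  rewrite (_ : (q - i.+1 == 0)%N = false) ?mulr0 //.
  by apply/eqP; lia.
have cq1 : c ^+ q.-1 = 1.
  apply: (mulfI cn0); rewrite mulr1 -exprS prednK ?(ltnW q_gt1) //.
  by rewrite /c exprMn exprVn aq bq invrN mulrNN.
have cN : c ^+ N = c.
  have [h qh] : exists h, q = h.*2.+1.
    by exists q./2; rewrite -[LHS]odd_double_half q_odd.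
  have -> : N = (q.-1 * h.+1).+1 by move: NE; rewrite qh -mul2n /=; nia.
  by rewrite exprS exprM cq1 expr1n mulr1.
have [w ->] : exists w, x = c * w by exists (x / c); rewrite mulrC divfK.
have n2 : 2%:R != 0 :> F := natr_odd_neq0 1 pF p_odd.
have -> : \sum_(i < q.-1) (gpoly F q i).[c * w] * a ^+ i.+1 * b ^+ (q - i.+1) =
    - (c * a) * (2%:R^-1 * (w ^+ N - (w + 1) ^+ N + 1)).
  have -> : 2%:R^-1 * (w ^+ N - (w + 1) ^+ N + 1) =
      (\sum_(i < q.-1) gpoly F q i).[w].
    by rewrite (sum_gpoly pF p_odd e_gt0 qE NE) !(hornerE, hornerXn).
  rewrite horner_sum mulr_sumr; apply: eq_bigr => -[i /= lti] _.
  rewrite horner_gpoly_mull // bE.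
  have qi : q = (i.+1 + (q - i.+1))%N by rewrite subnKC //; lia.
  (* The powers of c and a add up to q in every summand; c ^ q = c and a ^ q = - a then give the
     common factor - c a. *)
  transitivity (c ^+ q * a ^+ q * (gpoly F q i).[w]).
    by rewrite -exprMn [in (c * a) ^+ q]qi exprD !exprMn; ring.
  by rewrite -[q in c ^+ q]prednK ?(ltnW q_gt1) // exprS cq1 aq; ring.
have -> : (c * w + c) ^+ N = c * (w + 1) ^+ N.
  by rewrite -{2}[c]mulr1 -mulrDr exprMn cN.
by rewrite exprMn cN; field.
Qed.

(** * Consecutive squares *)

Lemma card_root_leq (R : finIdomainType) (A : {set R}) (P : {poly R}) n :
  P != 0 -> (size P <= n.+1)%N -> {in A, forall x, root P x} -> (#|A| <= n)%N.
Proof.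
move=> P0 sP rA; rewrite cardE -ltnS (leq_trans _ sP) //.
rewrite max_poly_roots ?enum_uniq //.
by apply/allP=> x; rewrite mem_enum => /rA.
Qed.

(** Multiplication by a nonzero x in A permutes the nonzero elements of A; comparing products shows
    that x is a root of X ^ #|A| - X, which has no room for further roots. *)
Lemma subfieldE (F : finFieldType) (A : {set F}) y : divring_closed A ->
  (y \in A) = (y ^+ #|A| == y).
Proof.
move=> [A1 AB AV].
have A0 : 0 \in A by rewrite -(subrr 1) AB.
have A_gt1 : (1 < #|A|)%N by apply/card_gt1P; exists 1, 0; rewrite oner_eq0.
have fixA x : x \in A -> x ^+ #|A| = x.
  move=> Ax; have [->|x0] := eqVneq x 0.
    by rewrite expr0n gtn_eqF // (ltnW A_gt1).
  have AM u : u \in A -> x * u \in A.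
    by move=> Au; rewrite -[u]invrK AV // -[u^-1]mul1r AV.
  have MA : [set x * u | u in A :\ 0] = A :\ 0.
    apply/eqP; rewrite eqEcard card_imset ?leqnn ?andbT; last exact: mulfI.
    apply/subsetP=> _ /imsetP[u Au ->]; move: Au; rewrite !inE => /andP[u0 Au].
    by rewrite mulf_neq0 // AM.
  have P0 : \prod_(u in A :\ 0) u != 0.
    by apply/prodf_neq0 => u; rewrite !inE => /andP[].
  have : \prod_(u in A :\ 0) u = x ^+ #|A :\ 0| * \prod_(u in A :\ 0) u.
    rewrite -{1}MA big_imset /=; last by move=> u v _ _; apply: mulfI.
    by rewrite big_split /= prodr_const.
  rewrite -{1}[\prod_(u in _) u]mul1r => /(mulIf P0) E.
  by rewrite (cardsD1 0) A0 exprS -E mulr1.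
apply/idP/eqP => [/fixA //|yA].
have sP : size ('X^#|A| - 'X : {poly F}) = #|A|.+1.
  by rewrite size_polyDl size_polyXn // size_polyN size_polyX.
suff : (#|y |: A| <= #|A|)%N.
  by rewrite cardsU1; case: (y \in A) => //; rewrite add1n ltnn.
apply: (@card_root_leq F _ ('X^#|A| - 'X)).
- by rewrite -size_poly_gt0 sP.
- by rewrite sP.
move=> x; rewrite !inE /root hornerD hornerN hornerXn hornerX subr_eq0.
by case/predU1P=> [->|/fixA->]; rewrite ?yA.
Qed.

Section SquareCounts.
Variables (F : finFieldType) (N : nat).
Hypotheses (n2 : 2%:R != 0 :> F) (N_odd : odd N) (cardF : (2 * N = #|F|.+1)%N).

Let N_gt1 : (1 < N)%N.
Proof.
have : (1 < #|F|)%N by apply/card_gt1P; exists 1, 0; rewrite oner_eq0.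
lia.
Qed.

(* The elements with x ^ ((Q + 1) / 2) = x are the squares, 0 included. *)
Definition sq : {set F} := [set x | x ^+ N == x].

Lemma sqPn (x : F) : x ^+ N = x \/ x ^+ N = - x.
Proof.
have : (x ^+ N) ^+ 2 = x ^+ 2.
  by rewrite -exprM mulnC cardF exprS expf_card.
by move/eqP; rewrite eqf_sqr => /orP[] /eqP; [left|right].
Qed.

Lemma nsqE x : x \notin sq -> x ^+ N = - x.
Proof. by rewrite inE; case: (sqPn x) => [->|//]; rewrite eqxx. Qed.

Lemma sq0 : 0 \in sq.
Proof. by rewrite inE expr0n; case: N N_gt1. Qed.

Lemma sq1 : 1 \in sq.
Proof. by rewrite inE expr1n. Qed.

Lemma sqN1 : -1 \in sq.
Proof. by rewrite inE -signr_odd N_odd expr1. Qed.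

Lemma nsq_neq0 x : x \notin sq -> x != 0.
Proof. by apply: contraNneq => ->; apply: sq0. Qed.

Lemma neq_opp (x : F) : x != 0 -> (- x == x) = false.
Proof.
move=> x0; apply/negP; rewrite eq_sym -addr_eq0 -mulr2n -mulr_natl.
by rewrite mulf_eq0 (negPf n2) (negPf x0).
Qed.

Lemma sq_mull a x : a != 0 -> a \in sq -> (a * x \in sq) = (x \in sq).
Proof.
move=> a0; rewrite !inE => /eqP aN; rewrite exprMn aN.
by apply/eqP/eqP => [/(mulfI a0)|->].
Qed.

Lemma nsq_mull a x : a \notin sq -> x != 0 -> (a * x \in sq) = (x \notin sq).
Proof.
move=> nsa x0; have a0 := nsq_neq0 nsa; rewrite !inE exprMn (nsqE nsa).
by case: (sqPn x) => ->; rewrite ?mulrNN ?mulNr ?eqxx neq_opp ?mulf_neq0.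
Qed.

Lemma sqV x : (x^-1 \in sq) = (x \in sq).
Proof. by rewrite !inE exprVn (inj_eq invr_inj). Qed.

(** Squares are roots of X ^ N - X and nonsquares of X ^ (N - 1) + 1; these bounds add up to #|F|,
    so both are attained. *)
Lemma card_nsq : #|~: sq| = N.-1.
Proof.
have le1 : (#|sq| <= N)%N.
  have sP : size ('X^N - 'X : {poly F}) = N.+1.
    by rewrite size_polyDl size_polyXn // size_polyN size_polyX.
  apply: (@card_root_leq F _ ('X^N - 'X)); rewrite -?size_poly_gt0 ?sP //.
  by move=> x; rewrite inE /root hornerD hornerN hornerXn hornerX subr_eq0.
have le2 : (#|~: sq| <= N.-1)%N.
  have sP : size ('X^(N.-1) + 1%:P : {poly F}) = N.-1.+1.
    by rewrite size_XnaddC //; move: N_gt1; clear; lia.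
  apply: (@card_root_leq F _ ('X^(N.-1) + 1%:P));
    rewrite -?size_poly_gt0 ?sP //.
  move=> x; rewrite inE => nsx; rewrite /root hornerD hornerXn hornerC.
  apply/eqP/(mulfI (nsq_neq0 nsx)).
  by rewrite mulr0 mulrDr -exprS prednK ?(ltnW N_gt1) // mulr1 nsqE // addNr.
have : (#|sq| + #|~: sq| = (2 * N).-1)%N by rewrite cardsC cardF.
move: le1 le2 N_gt1; lia.
Qed.

Definition nsq_nsq : {set F} := [set x | (x \notin sq) && (x + 1 \notin sq)].
Definition sq_sq : {set F} := [set x | (x \in sq) && (x + 1 \in sq)].

(* The map x |-> 1/x exchanges the x with x and x + 1 nonsquares and the x with
   x a nonsquare and x + 1 a square. *)
Lemma card_nsq_nsq : (2 * #|nsq_nsq| = N.-1)%N.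
Proof.
have nnE x : (x \in nsq_nsq) = (x \notin sq) && (x + 1 \notin sq).
  by rewrite inE.
have E : nsq_nsq = (@GRing.inv F) @^-1: (~: sq :\: nsq_nsq).
  apply/setP=> x; rewrite [RHS]in_set in_setD in_setC !nnE sqV.
  have [sx|nsx] := boolP (x \in sq); rewrite ?andbF //= andbT negbK.
  have x0 := nsq_neq0 nsx.
  have -> : x^-1 + 1 = x^-1 * (x + 1) by rewrite mulrDr mulVf // mulr1 addrC.
  (* The value x = -1 is excluded: -1 is a square because N is odd. *)
  have [x1|x1] := eqVneq (x + 1) 0; last by rewrite nsq_mull ?sqV.
  by move: nsx; rewrite -[x]opprK (addr0_eq x1) sqN1.
have sub : nsq_nsq \subset ~: sq.
  by apply/subsetP=> x; rewrite nnE in_setC => /andP[].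
have := cardsID nsq_nsq (~: sq); rewrite (setIidPr sub) card_nsq.
have : #|nsq_nsq| = #|~: sq :\: nsq_nsq|.
  by rewrite {1}E card_preimset //; apply: invr_inj.
lia.
Qed.

(** Inclusion-exclusion for the nonsquares and their translate by -1. *)
Lemma card_sq_sq : (2 * #|sq_sq| = N.+1)%N.
Proof.
pose T := (fun x => x + 1) @^-1: (~: sq).
have cT : #|T| = N.-1 by rewrite card_preimset ?card_nsq //; apply: addIr.
have I : ~: sq :&: T = nsq_nsq by apply/setP=> x; rewrite !in_set.
have U : ~: sq :|: T = ~: sq_sq by apply/setP=> x; rewrite !in_set negb_and.
have := cardsUI (~: sq) T; rewrite I U cT card_nsq.
have : (#|sq_sq| + #|~: sq_sq| = (2 * N).-1)%N by rewrite cardsC cardF.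
have := card_nsq_nsq; move: N_gt1; lia.
Qed.

(** * Derivatives of maps linear on squares and on nonsquares *)

Definition half_linear (u v x : F) : F := (if x \in sq then u else v) * x.

(** A nonsquare factor swaps squares and nonsquares, hence u and v. This reduces every direction a
    to direction 1. *)
Lemma half_linear_mull (u v a x : F) : a != 0 ->
  half_linear u v (a * x) =
  a * (if a \in sq then half_linear u v x else half_linear v u x).
Proof.
move=> a0; rewrite /half_linear mulrCA; have [sa|nsa] := boolP (a \in sq).
  by rewrite sq_mull // mulrCA mulrA [a * _]mulrC -mulrA mulrCA.
have [->|x0] := eqVneq x 0; first by rewrite !mulr0.
by rewrite nsq_mull //; case: (x \in sq); rewrite /= ?mulrA // [_ * a]mulrC.
Qed.

Definition diff_fiber (u v a b : F) : {set F} :=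
  [set x | half_linear u v (x + a) - half_linear u v x == b].

Lemma card_diff_fiber1 (u v b : F) : u != v ->
  (2 * #|diff_fiber u v 1%R b| <= N.+1)%N
  /\ (b = u ->
      #|diff_fiber u v 1 b| = #|sq_sq|).
Proof.
move=> uv; set D := diff_fiber _ _ _ _.
have uv0 : u - v != 0 by rewrite subr_eq0.
(* If x and x + 1 are of the same kind, the difference is the constant u or v; otherwise x solves a
   linear equation. *)
have DE (x : F) : (x \in D) =
    if x \in sq then if x + 1 \in sq then b == u else x * (v - u) == b - v
    else if x + 1 \in sq then x * (u - v) == b - u else b == v.
  rewrite in_set /half_linear.
  by case: (x \in sq); case: (x + 1 \in sq);
    rewrite -[LHS]subr_eq0 -[RHS]subr_eq0;
    [rewrite -[RHS]oppr_eq0 | | | rewrite -[RHS]oppr_eq0]; congr (_ == 0); ring.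
have mixed1 x : x * (u - v) == b - u -> x = (b - u) / (u - v).
  by move/eqP=> <-; rewrite mulfK.
have mixed2 x : x * (v - u) == b - v -> x = (b - v) / (v - u).
  by move/eqP=> <-; rewrite mulfK // -opprB oppr_eq0.
(* The mixed solutions would be x = -1 and x = 0, where x + 1 and x respectively would be the
   nonsquare 0. *)
have Du : b = u -> D = sq_sq.
  move=> bu; apply/setP=> x; rewrite DE [RHS]in_set bu (negPf uv) eqxx.
  have [sx|nsx] := boolP (x \in sq);
    have [sx1|nsx1] := boolP (x + 1 \in sq) => //.
    apply: contraNF nsx1; rewrite -opprB -subr_eq0.
    rewrite (_ : _ - _ = - (x + 1) * (u - v)); last by ring.
    by rewrite mulf_eq0 (negPf uv0) orbF oppr_eq0 => /eqP->; exact: sq0.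
  apply: contraNF (nsq_neq0 nsx).
  by rewrite subrr mulf_eq0 (negPf uv0) orbF.
have Dv : b = v -> D = nsq_nsq.
  move=> bv; apply/setP=> x; rewrite DE [RHS]in_set bv eq_sym (negPf uv) eqxx.
  have [sx|nsx] := boolP (x \in sq);
    have [sx1|nsx1] := boolP (x + 1 \in sq) => //.
    rewrite subrr mulf_eq0 subr_eq0 eq_sym [v == u]eq_sym (negPf uv) orbF.
    rewrite eq_sym.
    by apply: contraNF nsx1 => /eqP->; rewrite add0r sq1.
  apply: contraNF nsx; rewrite -subr_eq0.
  rewrite (_ : _ - _ = (x + 1) * (u - v)); last by ring.
  rewrite mulf_eq0 (negPf uv0) orbF addr_eq0 => /eqP->; exact: sqN1.
split; last by move/Du->.
have [/Du->|bu] := eqVneq b u; first by rewrite card_sq_sq.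
have [/Dv->|bv] := eqVneq b v.
  by rewrite card_nsq_nsq; move: N_gt1; clear; lia.
have sub : D \subset [set (b - u) / (u - v); (b - v) / (v - u)].
  apply/subsetP=> x; rewrite DE !inE (negPf bu) (negPf bv).
  by case: ifP; case: ifP => // _ _; [move/mixed2 | move/mixed1] => <-;
    rewrite eqxx ?orbT.
have := subset_leq_card sub.
have := cards2 ((b - u) / (u - v)) ((b - v) / (v - u)).
(* For N >= 3 a fibre of two points stays within (N + 1) / 2. *)
have : (2 < N)%N by move: N_odd N_gt1; case: N => [|[|[|]]].
by case: (_ != _) => /= N3 -> D2; lia.
Qed.

Lemma card_diff_fiber (u v a b : F) : u != v -> a != 0 ->
  (2 * #|diff_fiber u v a b| <= N.+1)%N.
Proof.
move=> uv a0; set D := diff_fiber _ _ _ _.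
have -> : #|D| = #|[set x | a * x \in D]|.
  by rewrite -(card_preimset D (mulfI a0)).
rewrite (_ : [set x | a * x \in D] = if a \in sq
  then diff_fiber u v 1 (b / a)
  else diff_fiber v u 1 (b / a)).
  by case: ifP => _; apply: (card_diff_fiber1 _ _).1; rewrite // eq_sym.
apply/setP=> x; rewrite in_set /D in_set -{2}[a]mulr1 -mulrDr.
rewrite !half_linear_mull //.
by case: ifP => _; rewrite in_set -mulrBr mulrC;
  apply: (can2_eq (mulfK a0) (mulfVK a0)).
Qed.

Lemma diff_uniformity_half_linear (f : {poly F}) (u v c d : F) : u != v ->
  (forall x, f.[x] = half_linear u v (x + c) + d) ->
  diff_uniformity f = ((#|F| + 3) %/ 4)%N.
Proof.
move=> uv fE.
have NE : (#|F| + 3 = 2 * N.+1)%N by lia.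
have half k : (2 * k = N.+1 -> k = (#|F| + 3) %/ 4)%N by rewrite NE => <-; lia.
have cardE a b : #|[set x | (Delta f a).[x] == b]| =
    #|diff_fiber u v a b|.
  rewrite -(card_preimset (diff_fiber u v a b) (addIr c)).
  apply: eq_card => x; rewrite !in_set /Delta hornerD hornerN horner_comp !fE.
  by rewrite !hornerE addrAC [x + a + c]addrAC; congr (_ == _); ring.
apply/eqP; rewrite eqn_leq; apply/andP; split.
  apply/bigmax_leqP => a a0; apply/bigmax_leqP => b _; rewrite cardE.
  by have := card_diff_fiber b uv a0; rewrite NE; lia.
rewrite -(half _ card_sq_sq) -((card_diff_fiber1 u uv).2 erefl) -cardE.
by apply: (bigmax_sup 1); rewrite ?oner_neq0 //; apply: (bigmax_sup u).
Qed.

End SquareCounts.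

(** * The two values of the differential uniformity *)

Lemma diff_uniformity_affine (F : finFieldType) (f : {poly F}) u d :
  (forall x, f.[x] = u * x + d) -> diff_uniformity f = #|F|.
Proof.
move=> fE; apply/eqP; rewrite eqn_leq; apply/andP; split.
  by apply/bigmax_leqP => a _; apply/bigmax_leqP => b _; apply: max_card.
apply: (bigmax_sup 1); rewrite ?oner_neq0 //; apply: (bigmax_sup u) => //.
rewrite -cardsT; apply: subset_leq_card; apply/subsetP => x _; rewrite inE.
rewrite /Delta hornerD hornerN horner_comp !fE !hornerE; apply/eqP; ring.
Qed.

Theorem lemma21 (p e q Q : nat) (p_prime : prime p) (p_odd : odd p)
    (e_gt0 : (0 < e)%N) (qE : q = (p ^ e)%N) (QE : Q = (q ^ 2)%N)
    (F : finFieldType) (cardF : #|F| = Q)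
    (Fq : {set F}) (Fq_subfield : divring_closed Fq) (cardFq : #|Fq| = q)
    (y z : F) :
  (y \in Fq -> diff_uniformity (fpoly q y z) = Q) /\
  (y \notin Fq -> diff_uniformity (fpoly q y z) = ((Q + 3) %/ 4)%N).
Proof.
rewrite QE in cardF *.
have pF : p \in [pchar F].
  by apply: (@card_finPcharP _ p (e * 2)) => //; rewrite cardF qE -expnM.
rewrite (subfieldE y Fq_subfield) cardFq; split=> [/eqP yq|yq].
  rewrite -cardF; apply: (@diff_uniformity_affine _ _ y z) => x.
  rewrite horner_fpoly yq subrr !mulr0 subr0 big1 ?subr0 1?mulrC // => i _.
  by rewrite expr0n !mulr0 mul0r.
have q_odd : odd q by rewrite qE oddX p_odd orbT.
have [N NE N_odd] : exists2 N, (2 * N = (q ^ 2).+1)%N & odd N.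
  (* For q = 2 h + 1, (q ^ 2 + 1) / 2 = 2 h (h + 1) + 1. *)
  exists (q./2.+1 * q./2).*2.+1; last by rewrite /= odd_double.
  by rewrite -[q in RHS]odd_double_half q_odd -!mul2n; nia.
have n2 : 2%:R != 0 :> F := natr_odd_neq0 1 pF p_odd.
rewrite -cardF; set c := (z ^+ q - z) / (y ^+ q - y).
apply: (@diff_uniformity_half_linear F N n2 N_odd _ _ y (y ^+ q) c (z - c * y)).
- by rewrite cardF.
- by rewrite eq_sym.
move=> x; rewrite (horner_fpoly_shift z x pF p_odd e_gt0 qE cardF NE yq) -/c.
congr (_ + _); rewrite /half_linear; set w := x + c.
(* For a square w the middle term vanishes and w y remains; for a nonsquare, w ^ N - w = - 2 w turns
   w y into w y ^ q. *)
have [|nsw] := boolP (w \in sq F N); first by rewrite inE => /eqP->; ring.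
by rewrite (nsqE _ nsw) ?cardF //; field.
Qed.
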